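(* Fix $r>0$ and $0<\sigma<\min(1,r^{-1})$. The sequence $$B_k(\sigma,r)=\sigma^k\Lambda_{k+1}(r),\qquad k\ge1,$$ tends to zero as $k\to\infty$ and is (weakly) unimodal in $k$, i.e. nondecreasing up to some index and nonincreasing from then on. Its maximum is attained. The set of maximisers is an interval of integers, possibly a single point. As $\sigma$ varies in $(0,\min(1,r^{-1}))$ with $r$ fixed, this set of maximisers can change only at values of $\sigma$ for which adjacent terms are equal, i.e. $B_k(\sigma,r)=B_{k+1}(\sigma,r)$ for some $k\ge1$ (it is constant on every subinterval containing no such value). The adjacent crossing values $$\sigma_k(r)=\frac{\Lambda_{k+1}(r)}{\Lambda_{k+2}(r)},\qquad k\ge1,$$ are nondecreasing in $k$. (Degeneracies are allowed: several adjacent equalities may occur at the same value of $\sigma$.)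
   Context: For $r>0$ and $h\ge1$, $A_h(r)$ is the $h\times h$ real symmetric tridiagonal matrix with zero diagonal and $(A_h(r))_{i,i+1}=(A_h(r))_{i+1,i}=r^{(i-1)/2}$ for $1\le i\le h-1$. $\lambda_h(r)$ denotes the spectral radius of $A_h(r)$, and $\Lambda_h(r)=\lambda_h(r)^2$. *)

(* Defs.v *)
From mathcomp Require Export all_boot all_order all_algebra.
From mathcomp Require Export all_classical all_reals all_analysis.
From mathcomp Require Export complex.
Set Implicit Arguments.
Unset Strict Implicit.
Unset Printing Implicit Defensive.
Import Order.TTheory GRing.Theory Num.Theory.
Import numFieldNormedType.Exports.
Local Open Scope classical_set_scope.
Local Open Scope ring_scope.

Section Spectral.
Variable R : realType.

Definition spectral_radius n (A : 'M[R]_n) : R :=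
  sup [set ComplexField.Normc.normc z |
       z in [set z : R[i] | eigenvalue (map_mx (real_complex R) A) z]].

(* Ordinals start at 0: the 1-based weight r^((i - 1) / 2) reads r^(i / 2). *)
Definition tridiag (h : nat) (r : R) : 'M[R]_h :=
  \matrix_(i < h, j < h)
    if (j : nat) == i.+1 then r `^ (i%:R / 2)
    else if (i : nat) == j.+1 then r `^ (j%:R / 2)
    else 0.

Definition lambda (h : nat) (r : R) : R := spectral_radius (tridiag h r).

Definition Lambda (h : nat) (r : R) : R := lambda h r ^+ 2.

(* Only the terms with k >= 1 belong to the sequence. *)
Definition B (k : nat) (sigma r : R) : R := sigma ^+ k * Lambda k.+1 r.

Definition crossing_value (k : nat) (r : R) : R := Lambda k.+1 r / Lambda k.+2 r.

Definition unimodal1 (u : nat -> R) : Prop :=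
  exists m : nat, [/\ (1 <= m)%N,
    forall j k : nat, (1 <= j)%N -> (j <= k)%N -> (k <= m)%N -> u j <= u k &
    forall j k : nat, (m <= j)%N -> (j <= k)%N -> u k <= u j].

Definition maximisers1 (u : nat -> R) : set nat :=
  [set k | (1 <= k)%N /\ forall j : nat, (1 <= j)%N -> u j <= u k].

Definition integer_interval (S : set nat) : Prop :=
  forall i j k : nat, S i -> S k -> (i <= j)%N -> (j <= k)%N -> S j.

Definition admissible (r sigma : R) : Prop :=
  0 < sigma /\ sigma < Num.min 1 r^-1.

Definition has_adjacent_equality (r sigma : R) : Prop :=
  exists2 k : nat, (1 <= k)%N & B k sigma r = B k.+1 sigma r.

End Spectral.

(* Main.v *)
(* The key point is that Lambda_h(r) is log-concave in h >= 1, i.e. that the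
   crossing values are monotone. The walks from a vertex of a weighted path graph
   grow like powers of its spectral radius, and translating the graph by one
   vertex multiplies the weights r^((i-1)/2) by sqrt r. It therefore suffices to
   compare pairs of walks confined to [2, h+1] and [1, h+2] with pairs confined
   to [1, h+1] and [2, h+2]: exchanging the two paths between their meeting
   points injects the former into the latter, with the same total weight. Given
   the monotone crossing values, B_{k+1} / B_k = sigma / sigma_k yields the
   rest. *)
Require Import Defs.
From mathcomp Require Import zify ring lra.
Set Implicit Arguments.
Unset Strict Implicit.
Unset Printing Implicit Defensive.
Import Order.TTheory GRing.Theory Num.Theory.
Import numFieldNormedType.Exports.
Local Open Scope classical_set_scope.
Local Open Scope ring_scope.

(** One step of two walks turns a product of counts into four weighted products, which are compared
    term by term. *)
Lemma ler_expand4 (R : realDomainType) (w1 w2 w3 w4 x1 x2 y1 y2 x1' x2' y1' y2' : R) :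
  0 <= w1 -> 0 <= w2 -> 0 <= w3 -> 0 <= w4 ->
  x1 * y1 <= x1' * y1' -> x1 * y2 <= x1' * y2' ->
  x2 * y1 <= x2' * y1' -> x2 * y2 <= x2' * y2' ->
  (w1 * x1 + w2 * x2) * (w3 * y1 + w4 * y2) <=
  (w1 * x1' + w2 * x2') * (w3 * y1' + w4 * y2').
Proof.
move=> w1_ge0 w2_ge0 w3_ge0 w4_ge0.
move=> /(ler_wpM2l (mulr_ge0 w1_ge0 w3_ge0)) h1.
move=> /(ler_wpM2l (mulr_ge0 w1_ge0 w4_ge0)) h2.
move=> /(ler_wpM2l (mulr_ge0 w2_ge0 w3_ge0)) h3.
move=> /(ler_wpM2l (mulr_ge0 w2_ge0 w4_ge0)) h4.
lra.
Qed.

(** * Exchange inequality for pairs of walks on a path *)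

Section Walks.
Variables (R : realType) (a : nat -> R).

(* Weighted count of the [n]-step walks from [i] on the integers of [lo, hi),
   the edge {i, i + 1} having weight [a i]; only used with [0 < lo], so that
   [i.-1] is a genuine predecessor. *)
Fixpoint walks lo hi n i : R :=
  if (lo <= i < hi)%N then
    if n is n'.+1 then
      a i.-1 * walks lo hi n' i.-1 + a i * walks lo hi n' i.+1
    else 1
  else 0.

Hypothesis a_ge0 : forall i, 0 <= a i.

Lemma walks_ge0 lo hi n i : 0 <= walks lo hi n i.
Proof.
elim: n i => [|n IH] i /=; case: ifP => // _.
by rewrite addr_ge0 // mulr_ge0.
Qed.

Lemma walks_out lo hi n i : ~~ (lo <= i < hi)%N -> walks lo hi n i = 0.
Proof. by case: n => [|n] /= /negbTE ->. Qed.

Lemma walksS lo hi n i : (lo <= i < hi)%N ->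
  walks lo hi n.+1 i =
  a i.-1 * walks lo hi n i.-1 + a i * walks lo hi n i.+1.
Proof. by move=> /= ->. Qed.

Variables L U : nat.
Hypothesis L_gt0 : (0 < L)%N.
Local Notation p := (walks L.+1 U).
Local Notation q := (walks L U.+1).
Local Notation p' := (walks L U).
Local Notation q' := (walks L.+1 U.+1).

(* A pair (P, Q) counted by [p * q] is cut at the meeting times of P and Q,
   which by parity separate the visits of Q to L from its visits to U. On a
   piece visiting L or U the order of P and Q is forced, and so is that of P'
   and Q'; on the other pieces both orders are allowed for both pairs. The third
   inequality is what survives of this exchange after a step from the diagonal,
   where the order of the two paths is lost. *)
Lemma walks_swap n i j : (i <= j)%N -> odd i = odd j ->
  [/\ p n i * q n j <= p' n i * q' n j,
      p n j * q n i <= p' n i * q' n j &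
      p n i * q n j + p n j * q n i <= p' n i * q' n j + p' n j * q' n i].
Proof.
elim: n i j => [|n IH] i j le_ij odd_ij.
  have d (lo hi k : nat) : walks lo hi 0 k = ((lo <= k < hi)%N : nat)%:R.
    by rewrite /=; case: ifP.
  rewrite !d -!natrM -!natrD !ler_nat.
  by rewrite !mulnb; split; lia.
have pq_ge0 lo hi k lo' hi' k' : 0 <= walks lo hi n.+1 k * walks lo' hi' n.+1 k'.
  by rewrite mulr_ge0 // walks_ge0.
have sub k : (L < k < U)%N -> [/\ L <= k < U, L <= k < U.+1 & L < k < U.+1]%N.
  by clear pq_ge0 => ?; split; lia.
have [eq_ij|ne_ij] := eqVneq i j.
  subst j.
  suff le_pq : p n.+1 i * q n.+1 i <= p' n.+1 i * q' n.+1 i.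
    by split=> //; apply: lerD.
  have [dp|/walks_out ->] := boolP (L < i < U)%N; last by rewrite mul0r.
  have [dp' dq dq'] := sub i dp.
  have [le_i odd_i] : (i.-1 <= i.+1)%N /\ odd i.-1 = odd i.+1.
    by clear pq_ge0; split; lia.
  rewrite !walksS // !mulrDl !mulrDr.
  have [h1 _ _] := IH i.-1 i.-1 (leqnn _) erefl.
  (* The two mixed terms, where the paths separate, carry the same weight [a i.-1 * a i]; only their
     sum has to be bounded, which is the third inequality. *)
  have [_ _ h2] := IH i.-1 i.+1 le_i odd_i.
  have [h3 _ _] := IH i.+1 i.+1 (leqnn _) erefl.
  have := ler_wpM2l (mulr_ge0 (a_ge0 i.-1) (a_ge0 i.-1)) h1.
  have := ler_wpM2l (mulr_ge0 (a_ge0 i.-1) (a_ge0 i)) h2.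
  have := ler_wpM2l (mulr_ge0 (a_ge0 i) (a_ge0 i)) h3.
  lra.
(* Vertex 0 lies left of [L], so the left sides vanish there; beyond it [i.-1] is a true
   predecessor, as the parity argument requires. *)
have [i0|i_gt0] := posnP i.
  have pi0 : p n.+1 i = 0 by apply: walks_out; rewrite i0.
  have qi0 : q n.+1 i = 0 by apply: walks_out; rewrite i0 leqNgt L_gt0.
  by rewrite pi0 qi0 !mul0r mulr0 addr0; split=> //; rewrite addr_ge0.
have dom1 : (L < i < U -> L <= j < U.+1 -> (L <= i < U) && (L < j < U.+1))%N.
  by clear pq_ge0 odd_ij; lia.
have dom2 : (L < j < U -> L <= i < U.+1 -> (L <= i < U) && (L < j < U.+1))%N.
  by clear pq_ge0 odd_ij; lia.
have dom3 : ((L < i) && (j < U) -> (L < i < U) && (L < j < U))%N.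
  by clear pq_ge0 odd_ij; lia.
(* Distinct positions of equal parity are at least 2 apart, so one step cannot make the paths
   cross. *)
have [l1 l2 l3 l4] : [/\ i.-1 <= j.-1, i.-1 <= j.+1, i.+1 <= j.+1
    & i.+1 <= j.-1]%N.
  by clear pq_ge0 dom1 dom2 dom3; split; lia.
have [par1 par2 par3 par4] : [/\ odd i.-1 = odd j.-1, odd i.-1 = odd j.+1,
    odd i.+1 = odd j.+1 & odd i.+1 = odd j.-1].
  by clear pq_ge0 dom1 dom2 dom3 l1 l2 l3 l4; split; lia.
have [h1 h1' h1s] := IH _ _ l1 par1.
have [h2 h2' h2s] := IH _ _ l2 par2.
have [h3 h3' h3s] := IH _ _ l3 par3.
have [h4 h4' h4s] := IH _ _ l4 par4.
have le1 : p n.+1 i * q n.+1 j <= p' n.+1 i * q' n.+1 j.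
  have [dp|/walks_out ->] := boolP (L < i < U)%N; last by rewrite mul0r.
  have [dq|/walks_out ->] := boolP (L <= j < U.+1)%N; last by rewrite mulr0.
  have /andP[dp' dq'] := dom1 dp dq.
  by rewrite !walksS //; exact: ler_expand4.
have le2 : p n.+1 j * q n.+1 i <= p' n.+1 i * q' n.+1 j.
  have [dp|/walks_out ->] := boolP (L < j < U)%N; last by rewrite mul0r.
  have [dq|/walks_out ->] := boolP (L <= i < U.+1)%N; last by rewrite mulr0.
  have /andP[dp' dq'] := dom2 dp dq.
  rewrite !walksS //.
  by rewrite mulrC; apply: ler_expand4 => //; rewrite mulrC.
split=> //.
have [/dom3/andP[di dj]|] := boolP ((L < i) && (j < U))%N.
  have [di1 di2 di3] := sub i di; have [dj1 dj2 dj3] := sub j dj.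
  rewrite !walksS //.
  have := ler_wpM2l (mulr_ge0 (a_ge0 i.-1) (a_ge0 j.-1)) h1s.
  have := ler_wpM2l (mulr_ge0 (a_ge0 i.-1) (a_ge0 j)) h2s.
  have := ler_wpM2l (mulr_ge0 (a_ge0 i) (a_ge0 j)) h3s.
  have := ler_wpM2l (mulr_ge0 (a_ge0 i) (a_ge0 j.-1)) h4s.
  clear; lra.
(* With [i] or [j] outside, one product on the left vanishes and [le2] or [le1] bounds the other. *)
rewrite negb_and => /orP[] /negbTE out.
  have pi0 : p n.+1 i = 0 by apply: walks_out; rewrite out.
  by rewrite pi0 mul0r add0r (le_trans le2) // lerDl.
have pj0 : p n.+1 j = 0 by apply: walks_out; rewrite out andbF.
by rewrite pj0 mul0r addr0 (le_trans le1) // lerDl.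
Qed.
End Walks.

(** Extending the eigenvector by zero lets one equation cover the endpoints of the interval too. *)
Record perron (R : realType) (a : nat -> R) (lo hi : nat) (mu : R)
    (v : nat -> R) : Prop := Perron {
  perron_gt0 : forall i, (lo <= i < hi)%N -> 0 < v i;
  perron_out : forall i, ~~ (lo <= i < hi)%N -> v i = 0;
  perron_eq : forall i, (lo <= i < hi)%N ->
    a i.-1 * v i.-1 + a i * v i.+1 = mu * v i }.

(** * Growth of walk counts and comparison of Perron eigenvalues *)

Section PerronWalks.
Variables (R : realType) (a : nat -> R) (lo hi : nat) (mu : R) (v : nat -> R).
Hypothesis a_ge0 : forall i, 0 <= a i.
Hypothesis mu_v : perron a lo hi mu v.

Lemma perron_ge0 i : 0 <= v i.
Proof.
by have [/(perron_gt0 mu_v)/ltW|/(perron_out mu_v) ->] := boolP (lo <= i < hi)%N.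
Qed.

(** Inside the interval [v i * mu ^+ n] obeys the recursion of the walk counts, so bounds at [n = 0]
    propagate. *)
Lemma perron_walks_bounds : exists c C : R, 0 < c /\
  forall n i, c * v i * mu ^+ n <= walks a lo hi n i <= C * v i * mu ^+ n.
Proof.
(* [C] dominates every [(v k)^-1] and [D] every [v k] on the interval; the summand 1 makes [D]
   positive. *)
pose C := 1 + \sum_(lo <= k < hi) (v k)^-1.
pose D := 1 + \sum_(lo <= k < hi) v k.
have D_gt0 : 0 < D.
  rewrite ltr_wpDr // sumr_ge0 // => k _; exact: perron_ge0.
have vD k : (lo <= k < hi)%N -> v k <= D.
  move=> dk; rewrite /D (bigD1_seq k) /= ?mem_index_iota ?iota_uniq //.
  rewrite addrCA lerDl addr_ge0 // sumr_ge0 // => l _; exact: perron_ge0.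
have vC k : (lo <= k < hi)%N -> (v k)^-1 <= C.
  move=> dk; rewrite /C (bigD1_seq k) /= ?mem_index_iota ?iota_uniq //.
  rewrite addrCA lerDl addr_ge0 // sumr_ge0 // => l _.
  by rewrite invr_ge0; exact: perron_ge0.
exists D^-1, C; split; rewrite ?invr_gt0 //; elim=> [|n IH] i.
  have [di|out] := boolP (lo <= i < hi)%N; last first.
    by rewrite walks_out // (perron_out mu_v) // !mulr0 !mul0r lexx.
  rewrite /= di expr0 !mulr1 ler_pdivrMl // mulr1 vD //=.
  by rewrite -ler_pdivrMr ?(perron_gt0 mu_v) // div1r vC.
have [di|out] := boolP (lo <= i < hi)%N; last first.
  by rewrite walks_out // (perron_out mu_v) // !mulr0 !mul0r lexx.
have E c : c * v i * mu ^+ n.+1 =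
    a i.-1 * (c * v i.-1 * mu ^+ n) + a i * (c * v i.+1 * mu ^+ n).
  rewrite exprS; have := perron_eq mu_v di; move: (mu ^+ n) => x e.
  transitivity (c * x * (mu * v i)); first by ring.
  by rewrite -e; ring.
have /andP[l1 u1] := IH i.-1; have /andP[l2 u2] := IH i.+1.
by rewrite walksS // !E !lerD // ler_wpM2l.
Qed.

End PerronWalks.

(** Were [y < x], [C * (y / x) ^+ n] would tend to 0 and fall below [c]. *)
Lemma ler_of_expM (R : realType) (c C x y : R) : 0 < c -> 0 <= y ->
  (forall n, c * x ^+ n <= C * y ^+ n) -> x <= y.
Proof.
move=> c_gt0 y_ge0 le_xy; rewrite leNgt; apply/negP => lt_yx.
have x_gt0 : 0 < x by exact: le_lt_trans lt_yx.
have q_lt1 : `|y / x| < 1.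
  by rewrite ger0_norm ?divr_ge0 ?(ltW x_gt0) // ltr_pdivrMr // mul1r.
have /cvgrPdist_lt : (geometric C (y / x)) @ \oo --> (0 : R) by exact: cvg_geometric.
move=> /(_ c c_gt0) [N _ /(_ N (leqnn _))] /=.
rewrite sub0r normrN => /(le_lt_trans (ler_norm _)); apply/negP; rewrite -leNgt.
rewrite expr_div_n mulrA ler_pdivlMr ?exprn_gt0 //.
Qed.

Lemma perron_mu_ge0 (R : realType) (a : nat -> R) lo hi mu v i :
  (forall i, 0 <= a i) -> perron a lo hi mu v -> (lo <= i < hi)%N -> 0 <= mu.
Proof.
move=> a_ge0 P di; rewrite -(pmulr_lge0 mu (perron_gt0 P di)) -(perron_eq P di).
by rewrite addr_ge0 // mulr_ge0 // (perron_ge0 P).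
Qed.

(** All walks start at [L.+1], a vertex common to the four intervals; the first inequality of
    [walks_swap] then compares products growing like [(mp * mq) ^+ n] and [(mp' * mq') ^+ n]. *)
Lemma perron_swap (R : realType) (a : nat -> R) L U (mp mq mp' mq' : R)
    (vp vq vp' vq' : nat -> R) :
  (forall i, 0 <= a i) -> (0 < L)%N -> (L.+1 < U)%N ->
  perron a L.+1 U mp vp -> perron a L U.+1 mq vq ->
  perron a L U mp' vp' -> perron a L.+1 U.+1 mq' vq' ->
  mp * mq <= mp' * mq'.
Proof.
move=> a_ge0 L_gt0 LU Pp Pq Pp' Pq'.
have [cp [Cp0 [cp_gt0 bp]]] := perron_walks_bounds a_ge0 Pp.
have [cq [Cq0 [cq_gt0 bq]]] := perron_walks_bounds a_ge0 Pq.
have [cp0 [Cp [_ bp']]] := perron_walks_bounds a_ge0 Pp'.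
have [cq0 [Cq [_ bq']]] := perron_walks_bounds a_ge0 Pq'.
have dp : (L.+1 <= L.+1 < U)%N by lia.
have dq : (L <= L.+1 < U.+1)%N by lia.
have dp' : (L <= L.+1 < U)%N by lia.
have dq' : (L.+1 <= L.+1 < U.+1)%N by lia.
apply: (@ler_of_expM _ (cp * vp L.+1 * (cq * vq L.+1))
  (Cp * vp' L.+1 * (Cq * vq' L.+1))).
- by rewrite !mulr_gt0 ?(perron_gt0 Pp) ?(perron_gt0 Pq).
- by rewrite mulr_ge0 ?(perron_mu_ge0 a_ge0 Pp' dp') ?(perron_mu_ge0 a_ge0 Pq' dq').
move=> n; rewrite !exprMn mulrACA [leRHS]mulrACA.
have [h _ _] := walks_swap a_ge0 U L_gt0 n (leqnn L.+1) erefl.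
have /andP[lp _] := bp n L.+1; have /andP[lq _] := bq n L.+1.
have /andP[_ up] := bp' n L.+1; have /andP[_ uq] := bq' n L.+1.
have mp_ge0 := perron_mu_ge0 a_ge0 Pp dp.
have mq_ge0 := perron_mu_ge0 a_ge0 Pq dq.
apply: (le_trans (ler_pM _ _ lp lq)).
- by rewrite !mulr_ge0 ?exprn_ge0 ?(perron_ge0 Pp) // ltW.
- by rewrite !mulr_ge0 ?exprn_ge0 ?(perron_ge0 Pq) // ltW.
apply: (le_trans h); apply: ler_pM => //; exact: walks_ge0.
Qed.

(** * Existence of Perron vectors by the three-term recurrence *)

Section JacobiSolution.
Variables (R : realType) (a : nat -> R).
Hypothesis a_gt0 : forall i, 0 < a i.

(* Solution of the eigenvalue equation of the Jacobi matrix with zero diagonal,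
   started from the boundary values 0 and 1; its zeros in [x] at index [h.+1]
   are the eigenvalues of the truncation to 1, ..., h. *)
Fixpoint jsol (x : R) (i : nat) : R :=
  match i with
  | 0 => 0
  | 1 => 1
  | (k.+1 as j).+1 => (x * jsol x j - a k * jsol x k) / a j
  end.

Lemma jsolSS x k :
  a k.+1 * jsol x k.+2 = x * jsol x k.+1 - a k * jsol x k.
Proof. by rewrite [jsol _ _.+2]/= mulrC divfK // gt_eqF. Qed.

Arguments jsol : simpl never.

Lemma jsol_continuous k : continuous (fun x => jsol x k).
Proof.
elim/ltn_ind: k => -[|[|k]] IH x; [exact: cvg_cst|exact: cvg_cst|].
apply: (@cvgMl R _ _ _ (fun x => x * jsol x k.+1 - a k * jsol x k)).
apply: cvgB; first by apply: cvgM; [exact: cvg_id|exact: (IH k.+1 _ x)].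
by apply: cvgM; [exact: cvg_cst|exact: (IH k _ x)].
Qed.

(** When [x] is a zero of [jsol _ k.+2], one product remains on the left, and the sum gives its sign
    for [y > x]. *)
Lemma christoffel_darboux x y k :
  a k.+1 * (jsol y k.+2 * jsol x k.+1 - jsol x k.+2 * jsol y k.+1) =
  (y - x) * \sum_(j < k.+1) jsol x j.+1 * jsol y j.+1.
Proof.
elim: k => [|k IH].
  rewrite big_ord_recr big_ord0 /jsol /= add0r; have := a_gt0 1; have := a_gt0 0.
  by move=> ? h; field; rewrite gt_eqF.
rewrite big_ord_recr /= [RHS]mulrDr -IH.
move: (jsolSS y k.+1) (jsolSS x k.+1).
move: (jsol y k.+3) (jsol x k.+3) (jsol y k.+2) (jsol x k.+2).
move: (jsol y k.+1) (jsol x k.+1) => y1 x1 y3 x3 y2 x2 ey ex.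
transitivity (a k.+2 * y3 * x2 - a k.+2 * x3 * y2); first by ring.
by rewrite ey ex; ring.
Qed.

(** Once [x] dominates each [a k + a k.+1], the recurrence forces growth; this supplies the right
    end for the intermediate value theorem. *)
Lemma jsol_large N : exists X, forall x, X <= x ->
  forall k, (k <= N)%N -> jsol x k <= jsol x k.+1 /\ 0 < jsol x k.+1.
Proof.
exists (\sum_(i < N.+1) (a i + a i.+1)) => x le_Xx; elim=> [|k IH] le_kN.
  by rewrite /jsol ltr01 ler01.
have [le_k pos_k] := IH (ltnW le_kN).
have le_x : a k + a k.+1 <= x.
  apply: le_trans le_Xx; rewrite (bigD1 (inord k)) //= inordK ?ltnS 1?ltnW //.
  by rewrite lerDl sumr_ge0 // => i _; rewrite addr_ge0 ?ltW.
suff le_kS : jsol x k.+1 <= jsol x k.+2 by split=> //; exact: lt_le_trans le_kS.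
rewrite -(ler_pM2l (a_gt0 k.+1)) jsolSS.
have := ler_wpM2l (ltW (a_gt0 k)) le_k.
have := ler_wpM2r (ltW pos_k) le_x.
lra.
Qed.

(** Interlacing of largest zeros: the next zero is found to the right of [mu], where the third
    clause already gives positivity of the earlier terms. *)
Lemma jsol_root h : (0 < h)%N -> exists mu, [/\ jsol mu h.+1 = 0,
  forall i, (0 < i <= h)%N -> 0 < jsol mu i &
  forall x, mu < x -> forall i, (0 < i <= h.+1)%N -> 0 < jsol x i].
Proof.
case: h => // h _; elim: h => [|h [mu [mu0 mu_pos gt_mu]]].
  exists 0; split=> [|[|[|i]] //|x x_gt0 [|[|[|i]]] //].
  - by rewrite /jsol mul0r mulr0 subr0 mul0r.
  - by rewrite /jsol mulr1 mulr0 subr0 divr_gt0.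
(* At the zero [mu] the middle term of the recurrence drops out, leaving a sign opposite to that of
   [jsol mu h.+1]. *)
have neg : jsol mu h.+3 < 0.
  rewrite -(pmulr_rlt0 _ (a_gt0 h.+2)) jsolSS mu0 mulr0 sub0r oppr_lt0.
  by rewrite mulr_gt0 // mu_pos /= ?leqnn.
have [X0 large] := jsol_large h.+2.
pose X := Num.max X0 mu.
have pos : 0 < jsol X h.+3.
  by have [] := large X _ h.+2 (leqnn _); rewrite ?le_max ?lexx.
have [nu nuI nu0] : exists2 c, c \in `[mu, X] & jsol c h.+3 = 0.
  apply: IVT; first by rewrite le_max lexx orbT.
    apply: continuous_subspaceT; exact: jsol_continuous.
  by rewrite ge_min le_max (ltW neg) (ltW pos) orbT.
have mu_nu : mu < nu.
  rewrite lt_neqAle; move: nuI; rewrite in_itv /= => /andP[-> _]; rewrite andbT.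
  by apply: contraTneq neg => ->; rewrite nu0 ltxx.
exists nu; split=> // [i|y nu_y i]; first exact: gt_mu.
rewrite [(i <= _)%N]leq_eqVlt andb_orr => /orP[/andP[_ /eqP ->]|]; last first.
  by apply: gt_mu; exact: lt_trans nu_y.
have := christoffel_darboux nu y h.+1; rewrite nu0 mul0r subr0 => CD.
have : 0 < a h.+2 * (jsol y h.+3 * jsol nu h.+2).
  rewrite CD mulr_gt0 ?subr_gt0 // big_ord_recr /= ltr_wpDl //.
    apply: sumr_ge0 => -[l lt_l] _; have dl : (0 < l.+1 <= h.+2)%N by rewrite /=; lia.
    by rewrite mulr_ge0 // ltW // gt_mu //; exact: lt_trans nu_y.
  by rewrite mulr_gt0 // gt_mu //= ?ltnS ?leqnn //; exact: lt_trans nu_y.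
by rewrite pmulr_rgt0 // pmulr_lgt0 // gt_mu //= leqnn.
Qed.

Lemma perron_ex h : (0 < h)%N -> exists mu v, perron a 1 h.+1 mu v.
Proof.
move=> h_gt0; have [mu [mu0 mu_pos _]] := jsol_root h_gt0.
(* Truncation is harmless up to [h.+1], since the solution vanishes at 0 and at [h.+1]. *)
have E i : (i <= h.+1)%N ->
    (if (0 < i < h.+1)%N then jsol mu i else 0) = jsol mu i.
  move=> le_i; case: ifP => // /negbT out.
  by have [->|->] : i = 0%N \/ i = h.+1 by lia.
exists mu, (fun i => if (0 < i < h.+1)%N then jsol mu i else 0); split.
- by move=> i di; rewrite di; apply: mu_pos.
- by move=> i /negbTE ->.
case=> // i /andP[_ lt_i]; rewrite !E ?jsolSS //=; try lia.
by rewrite addrC subrK.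
Qed.

End JacobiSolution.

(** * Spectral radius of a nonnegative matrix with a positive eigenvector *)

Section SpectralRadius.
Variable R : realType.
Local Notation normc := ComplexField.Normc.normc.

Lemma normc_sum_le I (s : seq I) (F : I -> R[i]) :
  normc (\sum_(i <- s) F i) <= \sum_(i <- s) normc (F i).
Proof.
elim/big_rec2: _ => [|i x y _ le_yx]; first by rewrite ComplexField.Normc.normc0.
by apply: (le_trans (le_normcD _ _)); rewrite lerD2l.
Qed.

Lemma normc_real (x : R) : 0 <= x -> normc x%:C%C = x.
Proof. by move=> x_ge0; rewrite /= expr0n addr0 sqrtr_sqr ger0_norm. Qed.

Lemma normc_ge0 (z : R[i]) : 0 <= normc z.
Proof. by case: z => x y; rewrite /= sqrtr_ge0. Qed.

(* Collatz-Wielandt: compare an eigenvector [w] with [v] at an index where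
   [|w j| / v j] is maximal. *)
Lemma eigenvalue_normc_le n (A : 'M[R]_n) (v : 'I_n -> R) c (z : R[i]) :
  (forall i j, 0 <= A i j) -> (forall i, 0 < v i) ->
  (forall j, \sum_i v i * A i j <= c * v j) ->
  eigenvalue (map_mx (real_complex R) A) z -> normc z <= c.
Proof.
move=> A_ge0 v_gt0 le_vA /eigenvalueP[w wA /rV0Pn[i0 wi0]].
case: (@Order.TotalTheory.arg_maxP _ _ _ i0 xpredT
  (fun i => normc (w 0 i) / v i) isT) => j _ max_j.
set m := normc (w 0 j) / v j in max_j.
have le_m i : normc (w 0 i) <= m * v i by rewrite -ler_pdivrMr //; exact: max_j.
have m_gt0 : 0 < m.
  apply: lt_le_trans (max_j i0 isT); rewrite divr_gt0 // lt_neqAle normc_ge0 andbT.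
  by apply: contra wi0 => /eqP/esym/ComplexField.Normc.eq0_normc ->.
have wj : normc (w 0 j) = m * v j by rewrite divfK // gt_eqF.
rewrite -(ler_pM2r (mulr_gt0 m_gt0 (v_gt0 j))) -{1}wj -ComplexField.Normc.normcM.
have -> : z * w 0 j = \sum_i w 0 i * (A i j)%:C%C.
  have /rowP/(_ j) := wA; rewrite !mxE => <-.
  by apply: eq_bigr => i _; rewrite mxE.
apply: (le_trans (normc_sum_le _ _)).
apply: (@le_trans _ _ (\sum_i m * (v i * A i j))).
  apply: ler_sum => i _.
  by rewrite ComplexField.Normc.normcM normc_real // mulrA ler_wpM2r.
by rewrite -mulr_sumr mulrCA ler_wpM2l // ltW.
Qed.

(** The vector [v] makes [mu] an eigenvalue, and [eigenvalue_normc_le] with [c = mu] bounds all the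
    others; eigenvectors are rows, hence the column sums. *)
Lemma spectral_radius_perron n (A : 'M[R]_n) (v : 'I_n -> R) mu :
  (0 < n)%N -> (forall i j, 0 <= A i j) -> (forall i, 0 < v i) ->
  (forall j, \sum_i v i * A i j = mu * v j) ->
  spectral_radius A = mu /\ eigenvalue (map_mx (real_complex R) A) mu%:C%C.
Proof.
move=> n_gt0 A_ge0 v_gt0 vA; pose i0 := Ordinal n_gt0.
have mu_ge0 : 0 <= mu.
  by rewrite -(pmulr_lge0 mu (v_gt0 i0)) -vA sumr_ge0 // => i _; rewrite mulr_ge0 // ltW.
have mu_eig : eigenvalue (map_mx (real_complex R) A) mu%:C%C.
  apply/eigenvalueP; exists (\row_i (v i)%:C%C).
    apply/rowP => j; rewrite !mxE -rmorphM -vA rmorph_sum /=.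
    by apply: eq_bigr => i _; rewrite !mxE rmorphM.
  apply/rV0Pn; exists i0; rewrite mxE fmorph_eq0 gt_eqF //.
split=> //; apply/eqP; rewrite eq_le; apply/andP; split.
  apply: ge_sup => [|x [z z_eig <-]]; first by exists (normc mu%:C%C), mu%:C%C.
  by apply: eigenvalue_normc_le z_eig => // j; rewrite vA.
apply: ub_le_sup; last by exists mu%:C%C => //; rewrite normc_real.
exists mu => x [z z_eig <-].
by apply: eigenvalue_normc_le z_eig => // j; rewrite vA.
Qed.

End SpectralRadius.

(* The matrix index [i] (from 0) becomes the vertex [i.+1], so the edge
   {i, i + 1} has weight s^(i-1); the junk weight at 0 only ever multiplies
   a boundary value 0. *)
Definition geom_weight (R : realType) (s : R) (i : nat) : R := s ^+ i.-1.

Lemma perron_geom_shift (R : realType) (s : R) h mu v :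
  perron (geom_weight s) 1 h.+1 mu v ->
  perron (geom_weight s) 2 h.+2 (s * mu) (fun i => v i.-1).
Proof.
move=> P; split.
- by case=> // i /= di; apply: (perron_gt0 P).
- by case=> [|i] /= out; apply: (perron_out P) => //; move: out; rewrite -!leqNgt; lia.
case=> // -[|i] // di /=.
have {di}di : (1 <= i.+1 < h.+1)%N by lia.
rewrite -mulrA -(perron_eq P di) mulrDr !mulrA /geom_weight /= -exprS.
(* Shifting multiplies a weight by [s] except at index 0, where the factor [v 0 = 0] hides the
   discrepancy. *)
case: i di => [|i] di //=.
by rewrite (perron_out P (i := 0)) // !mulr0 expr0 expr1 mulr1.
Qed.

(** * Log-concavity and size of the spectral radii *)

Section Tridiag.
Variables (R : realType) (r : R).
Hypothesis r_gt0 : 0 < r.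
Local Notation s := (Num.sqrt r).

Let s_gt0 : 0 < s. Proof. by rewrite sqrtr_gt0. Qed.

Lemma tridiagE h (i j : 'I_h) :
  tridiag h r i j = (if j == i.+1 :> nat then s ^+ i else 0) +
                    (if i == j.+1 :> nat then s ^+ j else 0).
Proof.
have powE (k : nat) : r `^ (k%:R / 2) = s ^+ k.
  by rewrite mulrC powRrM powR12_sqrt ?ltW // powR_mulrn // ltW.
rewrite mxE !powE; case: eqP => [->|_]; last by rewrite add0r.
by rewrite ltn_eqF ?addr0 // ltnS leqnSn.
Qed.

Lemma tridiag_ge0 h (i j : 'I_h) : 0 <= tridiag h r i j.
Proof.
by rewrite tridiagE addr_ge0 //; case: ifP => // _; rewrite exprn_ge0 // ltW.
Qed.

Lemma tridiag_colsum h (F : nat -> R) (j : 'I_h) :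
  \sum_(i < h) F i.+1 * tridiag h r i j =
  (if (0 < j)%N then s ^+ j.-1 * F j else 0) +
  (if (j.+1 < h)%N then s ^+ j * F j.+2 else 0).
Proof.
under eq_bigr do rewrite tridiagE mulrDr.
rewrite big_split /=; congr (_ + _).
  case: j => -[|j] lt_jh /=.
    by rewrite big1 // => i _; rewrite mulr0.
  under eq_bigr => i _ do
    rewrite eqSS eq_sym (fun_if (fun x => F i.+1 * x)) mulr0 mulrC.
  rewrite -big_mkcond (big_ord1_eq _ (fun i => s ^+ i * F i.+1)) (ltnW lt_jh).
  by [].
under eq_bigr => i _ do rewrite (fun_if (fun x => F i.+1 * x)) mulr0 mulrC.
by rewrite -big_mkcond (big_ord1_eq _ (fun i => s ^+ j * F i.+1)).
Qed.

Lemma lambda_perron h : (0 < h)%N ->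
  (exists v, perron (geom_weight s) 1 h.+1 (lambda h r) v) /\
  eigenvalue (map_mx (real_complex R) (tridiag h r)) (lambda h r)%:C%C.
Proof.
move=> h_gt0.
have [mu [v P]] : exists mu v, perron (geom_weight s) 1 h.+1 mu v.
  by apply: perron_ex => // i; rewrite exprn_gt0.
have [] := @spectral_radius_perron _ _ (tridiag h r)
  (fun i => v i.+1) mu h_gt0 (@tridiag_ge0 h).
- by move=> i; apply: (perron_gt0 P); rewrite /= ltnS.
- move=> j; rewrite tridiag_colsum -(perron_eq P) /= ?ltnS //.
  rewrite /geom_weight /=; congr (_ + _); case: ifP => //.
    by move=> /negbT out; rewrite (perron_out P) ?mulr0 //; lia.
  by move=> /negbT out; rewrite (perron_out P) ?mulr0 //; lia.
by move=> lamE eig; rewrite /lambda lamE; split; first by exists v.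
Qed.

Lemma lambda_gt0 h : (1 < h)%N -> 0 < lambda h r.
Proof.
move=> h_gt1; have [[v P] _] := lambda_perron (ltnW h_gt1).
have d1 : (1 <= 1 < h.+1)%N by lia.
rewrite -(pmulr_lgt0 _ (perron_gt0 P d1)) -(perron_eq P d1).
rewrite (perron_out P (i := 1.-1)) // mulr0 add0r mulr_gt0 ?exprn_gt0 //.
by apply: (perron_gt0 P).
Qed.

Lemma lambda_ge0 h : (0 < h)%N -> 0 <= lambda h r.
Proof.
move=> h_gt0; have [[v P] _] := lambda_perron h_gt0.
apply: (perron_mu_ge0 _ P (i := 1)); last by lia.
by move=> i; rewrite exprn_ge0 // ltW.
Qed.

Lemma lambda_log_concave h : (0 < h)%N ->
  lambda h r * lambda h.+2 r <= lambda h.+1 r ^+ 2.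
Proof.
move=> h_gt0.
have [[v0 P0] _] := lambda_perron h_gt0.
have [[v1 P1] _] := @lambda_perron h.+1 isT.
have [[v2 P2] _] := @lambda_perron h.+2 isT.
(* The extra factor [s] turns one eigenvalue on each side into that of a translated path;
   [perron_swap] applies with [L = 1] and [U = h.+2]. *)
rewrite -(ler_pM2l s_gt0) expr2 mulrA [leRHS]mulrCA.
apply: (perron_swap _ _ _ (perron_geom_shift P0) P2 P1 (perron_geom_shift P1)) => //.
by move=> i; rewrite exprn_ge0 // ltW.
Qed.

(** The constant test vector 1 leaves column sums, each with at most two nonzero entries. *)
Lemma lambda_le h : (0 < h)%N -> lambda h r <= 2 * Num.max 1 s ^+ h.
Proof.
move=> h_gt0; have [_ eig] := lambda_perron h_gt0.
rewrite -[leLHS]normc_real ?lambda_ge0 //.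
apply: (@eigenvalue_normc_le _ _ _ (fun=> 1) _ _ (@tridiag_ge0 h)) eig => // j.
rewrite (tridiag_colsum (fun=> 1)) mulr1 !mulr1 mulr_natl mulr2n.
have M_ge1 : 1 <= Num.max 1 s by rewrite le_max lexx.
have le_pow k : (k <= h)%N -> s ^+ k <= Num.max 1 s ^+ h.
  move=> le_kh; apply: (@le_trans _ _ (Num.max 1 s ^+ k)); last exact: ler_weXn2l.
  by rewrite lerXn2r ?nnegrE ?le_max ?lexx ?orbT ?ler01 // ltW.
have M_ge0 : 0 <= Num.max 1 s ^+ h by rewrite exprn_ge0 // (le_trans ler01).
by apply: lerD; case: ifP => // _; apply: le_pow; have := ltn_ord j; lia.
Qed.

(** * Crossing values, unimodality and maximisers *)

Lemma Lambda_gt0 k : (0 < k)%N -> 0 < Lambda k.+1 r.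
Proof. by move=> k_gt0; rewrite exprn_gt0 // lambda_gt0. Qed.

Lemma B_gt0 sigma k : 0 < sigma -> (0 < k)%N -> 0 < B k sigma r.
Proof. by move=> s0 k_gt0; apply: mulr_gt0; [exact: exprn_gt0|exact: Lambda_gt0]. Qed.

Lemma crossing_value_homo j k : (1 <= j)%N -> (j <= k)%N ->
  crossing_value j r <= crossing_value k r.
Proof.
move=> j_gt0 /subnKC <-; elim: (k - j)%N => [|d IH]; first by rewrite addn0.
rewrite addnS (le_trans IH) //; set m := (j + d)%N.
have m_gt0 : (0 < m)%N by rewrite addn_gt0 j_gt0.
rewrite /crossing_value ler_pdivrMr ?Lambda_gt0 // mulrAC ler_pdivlMr ?Lambda_gt0 //.
rewrite /Lambda -!exprMn -expr2 lerXn2r // ?nnegrE; last first.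
- exact: lambda_log_concave.
- by rewrite exprn_ge0 // ltW // lambda_gt0.
by rewrite mulr_ge0 // ltW // lambda_gt0.
Qed.

Lemma B_le_succ sigma k : 0 < sigma -> (0 < k)%N ->
  (B k sigma r <= B k.+1 sigma r) = (crossing_value k r <= sigma).
Proof.
move=> s0 k_gt0; rewrite /B /crossing_value exprSr -mulrA ler_pM2l ?exprn_gt0 //.
by rewrite ler_pdivrMr // Lambda_gt0.
Qed.

Lemma B_succ_le sigma k : 0 < sigma -> (0 < k)%N ->
  (B k.+1 sigma r <= B k sigma r) = (sigma <= crossing_value k r).
Proof.
move=> s0 k_gt0; rewrite /B /crossing_value exprSr -mulrA ler_pM2l ?exprn_gt0 //.
by rewrite ler_pdivlMr // Lambda_gt0.
Qed.

Lemma B_eq_succ sigma k : 0 < sigma -> (0 < k)%N ->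
  (B k sigma r = B k.+1 sigma r) <-> (sigma = crossing_value k r).
Proof.
move=> s0 k_gt0; split=> [/eqP|/eqP] e; apply/eqP; move: e; rewrite !eq_le.
  by rewrite B_le_succ // B_succ_le // andbC.
by rewrite B_le_succ // B_succ_le // andbC.
Qed.

(** By [lambda_le] the terms are at most [4 * M ^+ 2 * (sigma * M ^+ 2) ^+ k]; as [M ^+ 2] is the
    maximum of 1 and [r], admissibility makes the ratio less than 1. *)
Lemma B_cvg0 sigma : admissible r sigma -> B k sigma r @[k --> \oo] --> (0 : R).
Proof.
move=> [s0]; rewrite lt_min => /andP[s1 sr].
pose M := Num.max 1 s.
have M_gt0 : 0 < M by rewrite lt_max ltr01.
have q_lt1 : `|sigma * M ^+ 2| < 1.
  rewrite ger0_norm; last by rewrite mulr_ge0 ?exprn_ge0 // ltW.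
  rewrite /M; case: (leP 1 s) => _; last by rewrite expr1n mulr1.
  by rewrite sqr_sqrtr ?ltW // -ltr_pdivlMr // div1r.
apply: (@squeeze_cvgr _ _ _ _ (fun=> 0) (geometric (4 * M ^+ 2) (sigma * M ^+ 2))).
- apply: nearW => k; apply/andP; split.
    by rewrite mulr_ge0 ?sqr_ge0 // exprn_ge0 // ltW.
  rewrite /geometric /= /B exprMn [leRHS]mulrCA ler_pM2l ?exprn_gt0 //.
  have -> : 4 * M ^+ 2 * (M ^+ 2) ^+ k = (2 * M ^+ k.+1) ^+ 2.
    by rewrite [M ^+ k.+1]exprS -(exprM M 2 k) mulnC exprM; ring.
  rewrite /Lambda lerXn2r ?lambda_le // nnegrE ?lambda_ge0 //.
  by rewrite mulr_ge0 // exprn_ge0 // ltW.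
- exact: cvg_cst.
- exact: cvg_geometric.
Qed.

(** The peak is the first index whose crossing value exceeds [sigma]; without one, the positive
    terms would never decrease, contradicting the limit 0. *)
Lemma exists_peak sigma : admissible r sigma -> exists m, [/\ (1 <= m)%N,
  forall j, (1 <= j < m)%N -> crossing_value j r <= sigma &
  forall j, (m <= j)%N -> sigma <= crossing_value j r].
Proof.
move=> adm; have s0 := adm.1.
have ex : exists m, (1 <= m)%N && (sigma < crossing_value m r).
  apply: contrapT => no; have le_cr j : (1 <= j)%N -> crossing_value j r <= sigma.
    by move=> j1; rewrite leNgt; apply/negP => lt; apply: no; exists j; rewrite j1.
  have B1 j : B 1 sigma r <= B j.+1 sigma r.
    by elim: j => // j IH; rewrite (le_trans IH) // B_le_succ // le_cr.
  have /cvgrPdist_lt := B_cvg0 adm.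
  move=> /(_ _ (B_gt0 s0 (ltnSn 0))) [N _ /(_ N.+1 (leqnSn _))] /=.
  rewrite sub0r normrN ger0_norm ?ltW ?B_gt0 //.
  by apply/negP; rewrite -leNgt.
exists (ex_minn ex); case: ex_minnP => m /andP[m1 lt_m] min_m; split=> // j.
  move=> /andP[j1 jm]; rewrite leNgt; apply/negP => lt_j.
  by have := min_m j; rewrite j1 lt_j leqNgt jm => /(_ isT).
by move=> mj; rewrite (le_trans (ltW lt_m)) // crossing_value_homo.
Qed.

Lemma B_homo sigma m : 0 < sigma ->
  (forall j, (1 <= j < m)%N -> crossing_value j r <= sigma) ->
  forall j k, (1 <= j)%N -> (j <= k)%N -> (k <= m)%N ->
    B j sigma r <= B k sigma r.
Proof.
move=> s0 cr j k j1 /subnKC <-; elim: (k - j)%N => [|d IH]; first by rewrite addn0.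
rewrite addnS => le_m; rewrite (le_trans (IH (ltnW le_m))) // B_le_succ //.
  by rewrite cr // le_m addn_gt0 j1.
by rewrite addn_gt0 j1.
Qed.

Lemma B_nhomo sigma m : 0 < sigma -> (1 <= m)%N ->
  (forall j, (m <= j)%N -> sigma <= crossing_value j r) ->
  forall j k, (m <= j)%N -> (j <= k)%N -> B k sigma r <= B j sigma r.
Proof.
move=> s0 m1 cr j k mj /subnKC <-; elim: (k - j)%N => [|d IH]; first by rewrite addn0.
rewrite addnS (le_trans _ IH) // B_succ_le //.
  by rewrite cr // (leq_trans mj) // leq_addr.
by rewrite addn_gt0 (leq_trans m1 mj).
Qed.

Lemma B_unimodal sigma : admissible r sigma -> unimodal1 (fun k => B k sigma r).
Proof.
move=> adm; have [m [m1 le_cr ge_cr]] := exists_peak adm.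
by exists m; split=> //; [exact: B_homo adm.1 le_cr|exact: B_nhomo adm.1 m1 ge_cr].
Qed.

(** Being a maximiser thus depends on [sigma] only through its comparisons with the crossing
    values. *)
Lemma maximisers_crossing sigma k : 0 < sigma ->
  maximisers1 (fun k => B k sigma r) k <->
  [/\ (1 <= k)%N, forall j, (1 <= j < k)%N -> crossing_value j r <= sigma &
      forall j, (k <= j)%N -> sigma <= crossing_value j r].
Proof.
move=> s0; split=> [[k1 max_k]|[k1 le_cr ge_cr]].
  split=> // j.
    case: k k1 max_k => // -[|k] _ max_k /andP[j1 lt_jk]; first by lia.
    rewrite (le_trans (crossing_value_homo j1 (_ : j <= k.+1)%N)) //.
    by rewrite -B_le_succ // max_k.
  move=> kj; rewrite (le_trans _ (crossing_value_homo k1 kj)) //.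
  by rewrite -B_succ_le // max_k.
split=> // j j1; have [jk|/ltnW kj] := leqP j k.
  exact: (B_homo s0 le_cr).
exact: (B_nhomo s0 k1 ge_cr).
Qed.

End Tridiag.

Lemma unimodal1_maximisers (R : realType) (u : nat -> R) :
  unimodal1 u -> maximisers1 u !=set0 /\ integer_interval (maximisers1 u).
Proof.
move=> [m [m1 inc dec]]; split.
  exists m; split=> // j j1; have [jm|/ltnW mj] := leqP j m; first exact: inc.
  exact: dec.
move=> i j k [i1 max_i] [k1 max_k] ij jk; split; first exact: leq_trans ij.
(* Left of the peak [j] inherits maximality from [i], right of it from [k]. *)
move=> l l1; have [jm|/ltnW mj] := leqP j m.
  by rewrite (le_trans (max_i l l1)) // inc.
by rewrite (le_trans (max_k l l1)) // dec.
Qed.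

Theorem corollary7p4 (R : realType) (r : R) (hr : 0 < r) :
  [/\ forall sigma : R, admissible r sigma ->
        [/\ B k sigma r @[k --> \oo] --> (0 : R),
            unimodal1 (fun k => B k sigma r),
            maximisers1 (fun k => B k sigma r) !=set0 &
            integer_interval (maximisers1 (fun k => B k sigma r))],
      forall I : set R, is_interval I ->
        (forall sigma : R, I sigma -> admissible r sigma) ->
        (forall sigma : R, I sigma -> ~ has_adjacent_equality r sigma) ->
        forall s t : R, I s -> I t ->
          maximisers1 (fun k => B k s r) = maximisers1 (fun k => B k t r),
      forall (k : nat) (sigma : R), (1 <= k)%N -> admissible r sigma ->
        (B k sigma r = B k.+1 sigma r <-> sigma = crossing_value k r) &
      forall j k : nat, (1 <= j)%N -> (j <= k)%N ->
        crossing_value j r <= crossing_value k r].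
Proof.
split=> [sigma adm|I itvI admI neqI s t Is It|k sigma k1 [s0 _]|j k j1 jk].
- have uni := B_unimodal hr adm.
  by have [ne itv] := unimodal1_maximisers uni; split=> //; exact: B_cvg0.
- have s0 := (admI _ Is).1; have t0 := (admI _ It).1.
  (* An interval free of crossing values lies entirely on one side of each, so all its points make
     the same comparisons. *)
  have notI k : (1 <= k)%N -> ~ I (crossing_value k r).
    move=> k1 Ik; apply: (neqI _ Ik); exists k => //.
    by apply/(B_eq_succ hr) => //; exact: (admI _ Ik).1.
  have tr x y k : I x -> I y -> (1 <= k)%N ->
      (crossing_value k r <= x -> crossing_value k r <= y) /\
      (x <= crossing_value k r -> y <= crossing_value k r).
    move=> Ix Iy k1; split=> le_x; rewrite leNgt; apply/negP => /ltW le_y;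
      apply: (notI k k1).
    + by apply: (itvI y x) => //; rewrite le_x le_y.
    + by apply: (itvI x y) => //; rewrite le_x le_y.
  have sub x y : I x -> I y -> maximisers1 (fun k => B k x r) `<=`
      maximisers1 (fun k => B k y r).
    move=> Ix Iy k /(maximisers_crossing hr k (admI _ Ix).1)[k1 le_cr ge_cr].
    apply/(maximisers_crossing hr k (admI _ Iy).1); split=> // j dj.
      by have /andP[j1 _] := dj; apply: (tr x y j _ _ _).1 => //; exact: le_cr.
    by apply: (tr x y j _ _ _).2 => //; [exact: leq_trans dj|exact: ge_cr].
  by apply/seteqP; split; exact: sub.
- exact: B_eq_succ.
- exact: crossing_value_homo.
Qed.
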